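(* Let $(X,d)$ be a compact metric space and let $\phi$ be a continuous flow on $X$. The set $Sh(\phi)$ of shadowable points of $\phi$ satisfies the following properties. (a) $Sh(\phi)$ is $\phi$-invariant, possibly empty and noncompact; that is, it is always invariant, there are flows for which it is empty, and there are flows for which it is not compact. (b) $\phi$ has the POTP if and only if $Sh(\phi)=X$. (c) If $CR(\phi)\subseteq Sh(\phi)$, then $CR(\phi)=\Omega(\phi)$. (d) If $\phi$ is expansive and $CR(\phi)\subseteq Sh(\phi)$, then $CR(\phi)=\overline{Per(\phi)}$. (e) If $\psi$ is a continuous flow on a metric space $Y$ and $f:X\to Y$ is an equivalence between $\phi$ and $\psi$, then $f(Sh(\phi))=Sh(\psi)$.
   Context: A flow on $X$ is a map $\phi:X\times\mathbb{R}\to X$ with $\phi(x,0)=x$ and $\phi(\phi(x,s),t)=\phi(x,s+t)$ for all $x\in X$, $s,t\in\mathbb{R}$; it is assumed continuous, and $\phi_t(x)=\phi(x,t)$. For $I\subset\mathbb{R}$, $\phi_I(x)=\{\phi_t(x):t\in I\}$. A subset $\Lambda\subset X$ is $\phi$-invariant if $\phi_t(\Lambda)=\Lambda$ for all $t\in\mathbb{R}$. The closure of a set $A$ is denoted $\overline{A}$. Periodic points. A periodic point is a point $x\in X$ for which there is a minimal $t>0$ satisfying $\phi_t(x)=x$. $Per(\phi)$ is the set of periodic points of $\phi$. Pseudo-orbits. Given $\delta,T>0$, a $(\delta,T)$-pseudo-orbit is a sequence $(x_i,t_i)_{i\in\mathbb{Z}}$ in $X\times\mathbb{R}$ with $t_i\ge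 T$ and $d(\phi_{t_i}(x_i),x_{i+1})\le\delta$ for all $i\in\mathbb{Z}$. It passes through $p$ if $x_0=p$. Put $s_0=0$, $s_i=\sum_{j=0}^{i-1}t_j$ for $i>0$, $s_i=-\sum_{j=i}^{-1}t_j$ for $i<0$, and $x_0\star t=\phi_{t-s_i}(x_i)$ whenever $s_i\le t<s_{i+1}$. A $(\delta,T)$-chain is a finite sequence $(x_i,t_i)_{i=0}^m$ in $X\times\mathbb{R}$ with $t_i\ge T$ and $d(\phi_{t_i}(x_i),x_{i+1})\le\delta$ for $0\le i\le m-1$. Shadowing. $\mathrm{Rep}$ is the set of surjective strictly increasing maps $h:\mathbb{R}\to\mathbb{R}$ with $h(0)=0$. A $(\delta,T)$-pseudo-orbit $(x_i,t_i)_{i\in\mathbb{Z}}$ is $\varepsilon$-shadowed if there are $y\in X$ and $h\in\mathrm{Rep}$ with $d(x_0\star t,\phi_{h(t)}(y))\le\varepsilon$ for all $t\in\mathbb{R}$. The flow has the POTP (pseudo-orbit tracing property) if for every $\varepsilon>0$ there is $\delta>0$ such that every $(\delta,1)$-pseudo-orbit is $\varepsilon$-shadowed. A point $p\in X$ is shadowable if for every $\varepsilon>0$ there is $\delta>0$ such that every $(\delta,1)$-pseudo-orbit passing through $p$ is $\varepsilon$-shadowed; $Sh(\phi)$ is the set of shadowable points. Recurrence. A point $p$ is non-wandering if for every neighborhood $U$ of $p$ and every $T\in\mathbb{R}$ there is $t\ge T$ with $\phi_t(U)\cap U\ne\emptyset$; $\Omega(\phi)$ is the set of non-wandering points. Points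 $p,q$ are $(\delta,T)$-related if there are two $(\delta,T)$-chains $(x_i,t_i)_{i=0}^m$ and $(y_i,u_i)_{i=0}^n$ such that $p=x_0=y_n$ and $q=y_0=x_m$; $p\sim q$ means that they are $(\delta,T)$-related for all $\delta,T>0$. A point $p$ is chain recurrent if $p\sim p$; $CR(\phi)$ is the set of chain recurrent points. Expansiveness. $\phi$ is expansive if for every $\varepsilon>0$ there is $\delta>0$ such that whenever $x,y\in X$ and $h\in\mathrm{Rep}$ satisfy $d(\phi_t(x),\phi_{h(t)}(y))\le\delta$ for all $t\in\mathbb{R}$, then $y\in\phi_{(-\varepsilon,\varepsilon)}(x)$. Equivalence. An equivalence between continuous flows $\phi$ on $X$ and $\psi$ on a metric space $Y$ is a homeomorphism $f:X\to Y$ carrying orbits of $\phi$ onto orbits of $\psi$ such that for every $x\in X$ there is $h_x\in\mathrm{Rep}$, depending continuously on $x$, with $f^{-1}(\psi(f(x),t))=\phi(x,h_x(t))$ for all $t\in\mathbb{R}$.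
   Formalization: In (d) the conclusion is CR(φ) = closure of Per(φ) together with all fixed points of φ, since the printed one fails for the flow on a one-point space; the chains defining CR(φ) are required to have at least one jump (m ≥ 1), as otherwise CR(φ) = X and (c) fails. *)

(* Defs.v *)
From HB Require Import structures.
From mathcomp Require Import all_boot all_order all_algebra.
From mathcomp Require Import all_classical all_reals all_analysis.

Set Implicit Arguments.
Unset Strict Implicit.
Unset Printing Implicit Defensive.

Import Order.TTheory GRing.Theory Num.Theory.
Import numFieldNormedType.Exports.

Local Open Scope classical_set_scope.
Local Open Scope ring_scope.

Section flows.
Context {R : realType} {X : metricType R}.
Implicit Types (phi : X -> R -> X) (p q x y : X) (h : R -> R) (eps delta : R)
  (xs : int -> X) (ts : int -> R).

Definition continuous_flow phi : Prop :=
  [/\ forall x, phi x 0 = x,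
      forall x s t, phi (phi x s) t = phi x (s + t)
    & continuous (fun z : X * R => phi z.1 z.2)].

Definition flow_invariant phi (L : set X) : Prop :=
  forall t, phi^~ t @` L = L.

Definition flow_orbit phi x : set X := range (phi x).

Definition Sing phi : set X := [set x | forall t, phi x t = x].

(* A least positive return time is required, so fixed points are excluded. They
   are always chain recurrent, but the flow on a one-point space, which is
   expansive and has every point shadowable, has no periodic point in this sense.
   Hence [Per phi] and [Sing phi] both occur in the description of [CR phi] for
   expansive flows. *)
Definition Per phi : set X :=
  [set x | exists t, [/\ 0 < t, phi x t = x
    & forall s, 0 < s -> phi x s = x -> t <= s]].

Definition pseudo_orbit phi delta (T : R) xs ts : Prop :=
  forall i, T <= ts i /\ mdist (phi (xs i) (ts i)) (xs (i + 1)) <= delta.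

(* [Negz n] is -(n + 1), so the second branch is -(ts_{-1} + ... + ts_{-(n+1)}). *)
Definition switch_time ts (i : int) : R :=
  match i with
  | Posz n => \sum_(j < n) ts (Posz j)
  | Negz n => - \sum_(j < n.+1) ts (Negz j)
  end.

(* If all ts_i are bounded below by some T > 0, then exactly one index
   satisfies the condition; the default value 0 of [xget] is then irrelevant. *)
Definition star_index ts (u : R) : int :=
  xget 0 [set i | switch_time ts i <= u < switch_time ts (i + 1)].

Definition star phi xs ts (u : R) : X :=
  phi (xs (star_index ts u)) (u - switch_time ts (star_index ts u)).

Definition Rep : set (R -> R) :=
  [set h | [/\ {homo h : s t / s < t}, range h = setT & h 0 = 0]].

Definition shadowed phi eps xs ts : Prop :=
  exists y h, Rep h /\ forall u, mdist (star phi xs ts u) (phi y (h u)) <= eps.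

Definition POTP phi : Prop :=
  forall eps, 0 < eps -> exists2 delta, 0 < delta &
    forall xs ts, pseudo_orbit phi delta 1 xs ts -> shadowed phi eps xs ts.

Definition Sh phi : set X :=
  [set p | forall eps, 0 < eps -> exists2 delta, 0 < delta &
    forall xs ts, pseudo_orbit phi delta 1 xs ts -> xs 0 = p ->
      shadowed phi eps xs ts].

Definition Omega phi : set X :=
  [set p | forall U, nbhs p U -> forall T,
    exists2 t, T <= t & (phi^~ t @` U) `&` U !=set0].

(* The finite sequence (a_i, u_i) for 0 <= i <= m; values beyond m are unused. *)
Definition chain phi delta (T : R) (m : nat) (a : nat -> X) (u : nat -> R) : Prop :=
  (forall i, (i <= m)%N -> T <= u i) /\
  (forall i, (i < m)%N -> mdist (phi (a i) (u i)) (a i.+1) <= delta).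

(* At least one jump is required: if m = 0 were allowed, every point would be
   related to itself, hence chain recurrent, by the chain consisting of itself. *)
Definition chain_connects phi delta (T : R) p q : Prop :=
  exists m a u, [/\ (0 < m)%N, chain phi delta T m a u, a 0%N = p & a m = q].

Definition chain_related phi delta (T : R) p q : Prop :=
  chain_connects phi delta T p q /\ chain_connects phi delta T q p.

Definition chain_equiv phi p q : Prop :=
  forall delta T, 0 < delta -> 0 < T -> chain_related phi delta T p q.

Definition CR phi : set X := [set p | chain_equiv phi p p].

Definition expansive phi : Prop :=
  forall eps, 0 < eps -> exists2 delta, 0 < delta &
    forall x y h, Rep h ->
      (forall t, mdist (phi x t) (phi y (h t)) <= delta) ->
      (phi x @` [set s | - eps < s < eps]) y.

End flows.

(* [g] is the inverse homeomorphism of [f]; the dependence of [h x] on [x] is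
   continuous for the compact-open topology on functions from R to R. *)
Definition flow_equivalence {R : realType} {X Y : metricType R}
    (phi : X -> R -> X) (psi : Y -> R -> Y) (f : X -> Y) : Prop :=
  exists g : Y -> X,
    [/\ continuous f, continuous g, cancel f g & cancel g f] /\
    (forall x, f @` flow_orbit phi x = flow_orbit psi (f x)) /\
    exists h : X -> R -> R,
      [/\ forall x, Rep (h x),
          continuous (h : X -> {compact-open, R -> R})
        & forall x t, g (psi (f x) t) = phi x (h x t)].

(* Main.v *)
Require Import Defs.
From HB Require Import structures.
From mathcomp Require Import all_boot all_order all_algebra.
From mathcomp Require Import all_classical all_reals all_analysis.
From mathcomp Require Import lra zify.

Set Implicit Arguments.
Unset Strict Implicit.
Unset Printing Implicit Defensive.

Import Order.TTheory GRing.Theory Num.Theory.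
Import numFieldNormedType.Exports.

Local Open Scope classical_set_scope.
Local Open Scope ring_scope.

(** Everything rests on one reformulation.  A pseudo-orbit is a pair of sequences,
    and operations such as moving its base point, changing its jump times or
    speeding it up disturb the indexing.  The curve that it traces has no index:
    it is a map [g : R -> X] which over every time window of bounded length stays
    close to the genuine orbit of the window's left end ([quasi_orbit]).  On a
    compact space the curve of a fine pseudo-orbit is a fine quasi-orbit, because a
    window shorter than the jump times meets at most one jump
    ([star_quasi_orbit]), and a quasi-orbit sampled at the integers is a
    pseudo-orbit following it ([quasi_orbit_sample]).  So a point is shadowable iff
    fine quasi-orbits through it are traced ([ShP]); moreover the window length is
    immaterial, windows of length [T] controlling those of length [n T]
    ([quasi_orbitM]).

    Invariance is then seen by applying a time map of the flow to quasi-orbits.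
    For the POTP, a quasi-orbit starting near a shadowable [p] becomes one through
    [p] after changing its single value at time 0, so that shadowability is
    locally uniform ([Sh_locally_uniform]) and compactness makes [delta] uniform.
    The two examples are identity flows on compact sets of reals.  There a point of
    a nontrivial interval is never shadowable, since a quasi-orbit may drift slowly
    along the interval, while isolated points are; on [[0, 1]] nothing is
    shadowable, and on [[-1, 0]] together with the points [1 / n] the shadowable
    points accumulate at 0, which is not shadowable.

    For chain recurrence, a closed chain at a shadowable [p] unrolls to a periodic
    pseudo-orbit, and a tracing orbit comes back near [p] after every period
    ([CR_Sh_trace]), so [p] is non-wandering.  If the flow is moreover expansive,
    the tracing orbit and its translate by a period follow each other up to a time
    change, hence they coincide, and the tracing point is periodic or fixed.

    Under an equivalence, a pseudo-orbit of [psi] is pulled back piece by piece, the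
    time changes of the pieces being glued into one reparametrization
    ([Rep_glue]).  The pulled back jump times are only bounded below by some
    [c > 0], uniform in the point by compactness, and this is where the freedom in
    the window length is used. *)

(** * Switching times *)

Section switch_times.
Context {R : realType}.
Implicit Types (ts : int -> R) (T u : R) (i j : int).

Lemma switch_timeS ts i : switch_time ts (i + 1) = switch_time ts i + ts i.
Proof.
case: i => [n|[|n]].
- by rewrite -PoszD addn1 /= big_ord_recr.
- by rewrite /= big_ord0 big_ord1 addNr.
- have -> : Negz n.+1 + 1 = Negz n by lia.
  by rewrite /= [in RHS]big_ord_recr /= opprD addrNK.
Qed.

Lemma switch_time0 ts : switch_time ts 0 = 0.
Proof. by rewrite /= big_ord0. Qed.

Lemma switch_time_ge ts T i n : (forall i, T <= ts i) ->
  switch_time ts i + n%:R * T <= switch_time ts (i + n%:Z).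
Proof.
move=> tsT; elim: n => [|n IH]; first by rewrite mul0r !addr0.
have -> : i + n.+1%:Z = (i + n%:Z) + 1 by lia.
rewrite switch_timeS -natr1 mulrDl mul1r addrA.
by rewrite lerD.
Qed.

Lemma switch_time_mono ts T : 0 < T -> (forall i, T <= ts i) ->
  {homo switch_time ts : i j / i <= j}.
Proof.
move=> T0 tsT i j ij.
have -> : j = i + `|j - i|%N%:Z by lia.
apply: le_trans (switch_time_ge i `|j - i|%N tsT).
by rewrite lerDl mulr_ge0 // ltW.
Qed.

(** Jump times bounded below make the switching times tend to both infinities; the
    last one before [u] is obtained from the least [k] with
    [u < switch_time ts (- N + k)], for [N] large. *)
Lemma switch_time_cover ts T u : 0 < T -> (forall i, T <= ts i) ->
  exists i, switch_time ts i <= u < switch_time ts (i + 1).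
Proof.
move=> T0 tsT; pose N := Num.truncn (`|u| / T).
have uN : `|u| < N.+1%:R * T by rewrite -ltr_pdivrMr // truncnS_gt.
have := switch_time_ge 0 N.+1 tsT; rewrite switch_time0 add0r => hi.
have := switch_time_ge (- N.+1%:Z) N.+1 tsT.
rewrite addNr switch_time0 => lo.
have [u1 u2] := (ler_norm u, ler_norm (- u)); rewrite normrN in u2.
have ex : exists k, u < switch_time ts (- N.+1%:Z + k%:Z).
  exists (N.+1 + N.+1)%N.
  have -> : - N.+1%:Z + (N.+1 + N.+1)%N%:Z = 0 + N.+1%:Z by lia.
  by lra.
case: (ex_minnP ex) => [[|k] uk kmin].
  by move: uk; rewrite addr0; lra.
exists (- N.+1%:Z + k%:Z); apply/andP; split.
  by rewrite leNgt; apply/negP => /kmin; rewrite ltnn.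
by have -> : - N.+1%:Z + k%:Z + 1 = - N.+1%:Z + k.+1%:Z by lia.
Qed.

Lemma switch_time_inj ts T u i j : 0 < T -> (forall i, T <= ts i) ->
  switch_time ts i <= u < switch_time ts (i + 1) ->
  switch_time ts j <= u < switch_time ts (j + 1) -> i = j.
Proof.
move=> T0 tsT.
have mono := switch_time_mono T0 tsT.
wlog : i j / i <= j.
  by move=> W a b; case/orP: (le_total i j) => h; [|apply/esym]; apply: W.
rewrite le_eqVlt => /predU1P[->//|ij] /andP[_ a] /andP[b _].
have := mono (i + 1) j; rewrite lezD1 => /(_ ij) c; exfalso; lra.
Qed.

Lemma star_index_eq ts T u i : 0 < T -> (forall i, T <= ts i) ->
  switch_time ts i <= u < switch_time ts (i + 1) -> star_index ts u = i.
Proof.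
move=> T0 tsT ui; apply: (switch_time_inj T0 tsT _ ui).
exact: (@xgetPex _ _ [set i | switch_time ts i <= u < switch_time ts (i + 1)])
  (switch_time_cover u T0 tsT).
Qed.

(** The form in which [star] is used everywhere below: the chosen index is replaced
    by any index known to satisfy the defining inequalities. *)
Lemma star_eq {X : metricType R} (phi : X -> R -> X) xs ts T u i :
    0 < T -> (forall i, T <= ts i) ->
    switch_time ts i <= u < switch_time ts (i + 1) ->
  star phi xs ts u = phi (xs i) (u - switch_time ts i).
Proof. by move=> T0 tsT ui; rewrite /star (star_index_eq T0 tsT ui). Qed.

End switch_times.

(** * Compactness in metric spaces *)

Section dist.
Context {R : realType} {X : metricType R}.
Implicit Types x y z : X.

Lemma mdist_le_trans x y z (a b : R) :
  mdist x y <= a -> mdist y z <= b -> mdist x z <= a + b.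
Proof. by move=> xy yz; apply: le_trans (metric_triangle x y z) (lerD xy yz). Qed.

Lemma mdist_leC x y (a : R) : mdist x y <= a -> mdist y x <= a.
Proof. by rewrite metric_sym. Qed.

Lemma near_mdist (x : X) (e : R) : 0 < e -> \forall y \near x, mdist x y <= e.
Proof.
move=> e0; have := nbhsx_ballx x _ e0; rewrite ballEmdist.
by apply: filterS => y /ltW.
Qed.

Lemma nbhs_mdist (x : X) (U : set X) : nbhs x U ->
  exists2 e : R, 0 < e & forall y, mdist x y <= e -> U y.
Proof.
rewrite -filter_from_ballE => -[e /= e0 eU]; exists (e / 2) => [|y xy].
  by rewrite divr_gt0.
apply: eU; rewrite ballEmdist /=; apply: le_lt_trans xy _.
by rewrite gtr_pMr ?invf_lt1 ?ltr1n.
Qed.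

End dist.

(** The finite-subcover argument shared by all uniformity statements: a radius that
    can be chosen locally uniformly can be chosen uniformly. *)
Lemma compact_uniform_radius {R : realType} {Z : topologicalType} (K : set Z)
    (P : R -> Z -> Prop) : compact K ->
    (forall d d' z, d' <= d -> P d z -> P d' z) ->
    (forall z : Z, K z -> exists2 d, 0 < d & \forall z' \near z, P d z') ->
  exists2 d, 0 < d & forall z, K z -> P d z.
Proof.
move=> cK mono loc; have /compact_near_coveringP cov := cK.
have [|e /= e0 sub] := cov R (0 : R)^'+ P _.
  move=> z /loc[d d0 Pd].
  exists ([set z' | P d z'], [set e | e <= d]) => /=.
    by split=> //; exact: nbhs_right_le.
  by move=> [y e] /= [Py ed]; apply: mono Py.
have e20 : 0 < e / 2 by rewrite divr_gt0.
exists (e / 2) => //; apply: (sub (e / 2) _ e20).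
by rewrite /= sub0r normrN gtr0_norm // gtr_pMr ?invf_lt1 ?ltr1n.
Qed.

(** Heine's theorem with parameters in [K]: a time interval when [F] is a flow, a
    single point when [F] is a plain map. *)
Lemma compact_equicontinuous_dist {R : realType} {X Y : metricType R}
    {P : topologicalType} (F : X * P -> Y) (K : set P) (eps : R) :
    compact [set: X] -> compact K -> continuous F -> 0 < eps ->
  exists2 delta, 0 < delta & forall x y s, K s -> mdist x y <= delta ->
    mdist (F (x, s)) (F (y, s)) <= eps.
Proof.
move=> cX cK cF eps0.
have [d d' z dd H y zy|[x s] [_ /= Ks]|d d0 H] :=
    compact_uniform_radius (P := fun d z => forall y, mdist z.1 y <= d ->
      mdist (F z) (F (y, z.2)) <= eps) (compact_setX cX cK).
- by apply: H; apply: le_trans dd.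
- have e20 : 0 < eps / 2 by rewrite divr_gt0.
  have [[A B] /= [nA nB] AB] := cF (x, s) _ (near_mdist (F (x, s)) e20).
  have [r r0 rA] := nbhs_mdist nA.
  have r20 : 0 < r / 2 by rewrite divr_gt0.
  exists (r / 2) => //.
  exists ([set y | mdist x y <= r / 2], B) => /=.
    by split => //; exact: near_mdist.
  move=> [y t] /= [xy Bt] z yz.
  rewrite (splitr eps); apply: (@mdist_le_trans _ _ _ (F (x, s))).
    apply: mdist_leC; apply: (AB (y, t)); split=> //; apply: rA.
    by apply: le_trans xy _; lra.
  apply: (AB (z, t)); split=> //; apply: rA; rewrite (splitr r).
  exact: mdist_le_trans xy yz.
- by exists d => // x y s Ks xy; apply: (H (x, s)).
Qed.

(** * Quasi-orbits and shadowable points *)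

Section quasi_orbits.
Context {R : realType} {X : metricType R}.
Implicit Types (phi : X -> R -> X) (g : R -> X) (T eps delta u : R).

(** Index-free counterpart of a pseudo-orbit; the curve [g] may be discontinuous. *)
Definition quasi_orbit phi delta T g : Prop :=
  forall t s, 0 <= s <= T -> mdist (phi (g t) s) (g (t + s)) <= delta.

Definition traced phi eps g : Prop :=
  exists y h, Rep h /\ forall u, mdist (g u) (phi y (h u)) <= eps.

Lemma traced_near phi eps eps' g g' : (forall u, mdist (g' u) (g u) <= eps') ->
  traced phi eps g -> traced phi (eps' + eps) g'.
Proof.
move=> gg [y [h [Rh gy]]]; exists y, h; split=> // u.
exact: mdist_le_trans (gg u) (gy u).
Qed.

Lemma quasi_orbit_le phi delta delta' T g : delta <= delta' ->
  quasi_orbit phi delta T g -> quasi_orbit phi delta' T g.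
Proof. by move=> dd q t s sT; apply: le_trans dd; apply: q. Qed.

Lemma flow_equicontinuous phi T eps :
    compact [set: X] -> continuous_flow phi -> 0 < eps ->
  exists2 delta, 0 < delta & forall x y s, `|s| <= T -> mdist x y <= delta ->
    mdist (phi x s) (phi y s) <= eps.
Proof.
move=> cX [_ _ cphi] eps0.
have cK : compact (`[- T, T] : set R) by exact: segment_compact.
have [d d0 H] := compact_equicontinuous_dist cX cK cphi eps0.
by exists d => // x y s sT xy; apply: H => //; rewrite /= in_itv /= -ler_norml.
Qed.

Lemma star_switch_time phi xs ts T i : continuous_flow phi -> 0 < T ->
  (forall i, T <= ts i) -> star phi xs ts (switch_time ts i) = xs i.
Proof.
move=> [phi0 _ _] T0 tsT; rewrite (@star_eq _ _ _ _ _ T _ i) ?subrr ?phi0 //.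
by rewrite lexx switch_timeS ltrDl (lt_le_trans T0).
Qed.

Lemma star0 phi xs ts T : continuous_flow phi -> 0 < T ->
  (forall i, T <= ts i) -> star phi xs ts 0 = xs 0.
Proof.
by move=> fphi T0 tsT; rewrite -[in LHS](switch_time0 ts) (star_switch_time _ _ fphi T0).
Qed.

(** A window [[t, t + s]] with [s <= T] contains at most one switching time.  Without
    one the curve is a genuine orbit on it; with one, the flow has at most the time
    [T] to amplify the jump. *)
Lemma star_quasi_orbit phi T eps :
    compact [set: X] -> continuous_flow phi -> 0 < T -> 0 < eps ->
  exists2 delta, 0 < delta & forall xs ts, pseudo_orbit phi delta T xs ts ->
    quasi_orbit phi eps T (star phi xs ts).
Proof.
move=> cX fphi T0 eps0; have [d d0 H] := flow_equicontinuous T cX fphi eps0.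
have [_ phiD _] := fphi.
exists d => // xs ts po t s /andP[s0 sT].
have tsT i : T <= ts i by have [] := po i.
have [i /andP[it ti]] := switch_time_cover t T0 tsT.
rewrite (@star_eq _ _ _ _ _ T t i) ?it // phiD.
have [lt|ge] := ltP (t + s) (switch_time ts (i + 1)).
  rewrite (@star_eq _ _ _ _ _ T (t + s) i) //; last by apply/andP; split; lra.
  by rewrite addrAC mdistxx ltW.
have := tsT (i + 1) => tsi1.
have e := switch_timeS ts (i + 1); have e' := switch_timeS ts i.
rewrite (@star_eq _ _ _ _ _ T (t + s) (i + 1)) //; last by apply/andP; split; lra.
have -> : t - switch_time ts i + s = ts i + (t + s - switch_time ts (i + 1)) by lra.
rewrite -phiD; apply: H; last by have [] := po i.
by rewrite ger0_norm; lra.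
Qed.

(** Errors accumulated over [n + 1] consecutive windows are controlled by uniform
    continuity of the flow over one window.  Thus pseudo-orbits with jump times at
    least [c], for any fixed [c > 0], are traced as well as those with jump times at
    least 1. *)
Lemma quasi_orbitM phi T n eps :
    compact [set: X] -> continuous_flow phi -> 0 < T -> 0 < eps ->
  exists2 delta, 0 < delta & forall g, quasi_orbit phi delta T g ->
    quasi_orbit phi eps (n.+1%:R * T) g.
Proof.
move=> cX fphi T0; have [_ phiD _] := fphi.
elim: n eps => [|n IH] eps eps0; first by exists eps => // g; rewrite mul1r.
have e20 : 0 < eps / 2 by rewrite divr_gt0.
have [d1 d10 H1] := flow_equicontinuous T cX fphi e20.
have [d2 d20 H2] : exists2 delta, 0 < delta & forall g,
    quasi_orbit phi delta T g -> quasi_orbit phi (Num.min d1 eps) (n.+1%:R * T) g.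
  by apply: IH; rewrite lt_min d10.
exists (Num.min d2 (eps / 2)) => [|g q t s]; first by rewrite lt_min d20.
have q2 : quasi_orbit phi (Num.min d1 eps) (n.+1%:R * T) g.
  by apply: H2; apply: quasi_orbit_le q; rewrite ge_min lexx.
rewrite -natr1 mulrDl mul1r; set T' := n.+1%:R * T => /andP[s0 sT].
have T'0 : 0 < T' by rewrite mulr_gt0.
have [le|gt] := leP s T'.
  by apply: (le_trans (q2 t s _)); rewrite ?s0 // ge_min lexx orbT.
have -> : s = T' + (s - T') by rewrite addrC subrK.
rewrite -phiD addrA (splitr eps).
apply: (@mdist_le_trans _ _ _ (phi (g (t + T')) (s - T'))).
  apply: H1; first by rewrite ger0_norm; lra.
  by apply: (le_trans (q2 t T' _)); [rewrite (ltW T'0) lexx | rewrite ge_min lexx].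
apply: (le_trans (q _ _ _)); first by apply/andP; split; lra.
by rewrite ge_min lexx orbT.
Qed.

Lemma switch_time1 i : switch_time (fun=> 1 : R) i = i%:~R.
Proof.
by case: i => n /=; rewrite sumr_const card_ord.
Qed.

Lemma quasi_orbit_sample phi delta g : quasi_orbit phi delta 1 g ->
  pseudo_orbit phi delta 1 (fun i => g i%:~R) (fun=> 1) /\
  forall u, mdist (star phi (fun i => g i%:~R) (fun=> 1) u) (g u) <= delta.
Proof.
move=> q; split=> [i|u]; first by split=> //; rewrite intrD; apply: q; lra.
have /andP[lo hi] := floor_itv u.
rewrite (@star_eq _ _ _ _ _ 1 _ (Num.floor u)) // !switch_time1 ?lo //.
rewrite -[X in mdist _ (g X)](subrKC (Num.floor u)%:~R u).
by apply: q; move: hi; rewrite intrD; lra.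
Qed.

(** Both conversions preserve the base point: the curve of a pseudo-orbit is at
    [xs 0] at time 0, and so is its sample. *)
Lemma ShP phi p : compact [set: X] -> continuous_flow phi ->
  Sh phi p <-> forall eps, 0 < eps -> exists2 delta, 0 < delta &
    forall g, quasi_orbit phi delta 1 g -> g 0 = p -> traced phi eps g.
Proof.
move=> cX fphi; split=> Sp eps eps0.
  have e20 : 0 < eps / 2 by rewrite divr_gt0.
  have [d d0 H] := Sp _ e20; exists (Num.min d (eps / 2)).
    by rewrite lt_min d0.
  move=> g q g0.
  have qd : quasi_orbit phi d 1 g.
    by apply: quasi_orbit_le q; rewrite ge_min lexx.
  have qe : quasi_orbit phi (eps / 2) 1 g.
    by apply: quasi_orbit_le q; rewrite ge_min lexx orbT.
  rewrite (splitr eps).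
  apply: traced_near (H _ _ (quasi_orbit_sample qd).1 g0) => u.
  by apply: mdist_leC; apply: (quasi_orbit_sample qe).2.
have [d d0 H] := Sp _ eps0.
have [d' d'0 H'] := star_quasi_orbit cX fphi (ltr01 : 0 < 1 :> R) d0.
exists d' => // xs ts po x0; apply: H; first exact: H'.
by rewrite (star0 _ fphi ltr01) // => i; have [] := po i.
Qed.

End quasi_orbits.

(** * Invariance and the pseudo-orbit tracing property *)

Section invariance_and_POTP.
Context {R : realType} {X : metricType R} (phi : X -> R -> X).
Context (cX : compact [set: X]) (fphi : continuous_flow phi).
Implicit Types (p : X) (eps : R).

(** The time map [phi^~ (- s)] carries quasi-orbits through [phi p s] to quasi-orbits
    through [p], and commutes with the flow, so tracing is carried back. *)
Lemma Sh_flow p s : Sh phi p -> Sh phi (phi p s).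
Proof.
have [phi0 phiD _] := fphi; move=> /(ShP _ cX fphi) Sp.
apply/(ShP _ cX fphi) => eps eps0.
have [e e0 He] := flow_equicontinuous `|s| cX fphi eps0.
have [d d0 Hd] := Sp _ e0.
have [d' d'0 Hd'] := flow_equicontinuous `|s| cX fphi d0.
exists d' => // g q g0.
have [t r tr||y [h [Rh gy]]] := Hd (fun t => phi (g t) (- s)).
- rewrite phiD addrC -phiD.
  by apply: Hd'; [rewrite normrN | exact: q].
- by rewrite g0 phiD subrr phi0.
exists (phi y s), h; split=> // u.
rewrite phiD addrC -phiD -[g u]phi0 -(subrr s) addrC -phiD.
exact: He.
Qed.

Lemma Sh_invariant : flow_invariant phi (Sh phi).
Proof.
have [phi0 phiD _] := fphi => t; apply/seteqP; split=> [_ [x Sx <-]|x Sx].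
  exact: Sh_flow.
by exists (phi x (- t)); [exact: Sh_flow | rewrite phiD addNr phi0].
Qed.

(** Quasi-orbits need not be continuous, so replacing the value at time 0 by [p] yields
    again a quasi-orbit: only windows starting or ending at 0 are affected. *)
Lemma Sh_locally_uniform p eps : Sh phi p -> 0 < eps ->
  exists2 delta, 0 < delta & forall g, quasi_orbit phi delta 1 g ->
    mdist p (g 0) <= delta -> traced phi eps g.
Proof.
have [phi0 phiD _] := fphi; move=> /(ShP _ cX fphi) Sp eps0.
have e20 : 0 < eps / 2 by rewrite divr_gt0.
have [d d0 Hd] := Sp _ e20.
have d20 : 0 < d / 2 by rewrite divr_gt0.
have [r r0 Hr] := flow_equicontinuous 1 cX fphi d20.
pose m := Num.min (eps / 2) (Num.min r (d / 2)).
exists m => [|g q pg]; first by rewrite !lt_min e20 r0.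
have me : m <= eps / 2 by rewrite ge_min lexx.
have mr : m <= r by rewrite !ge_min lexx !orbT.
have md : m <= d / 2 by rewrite !ge_min lexx !orbT.
(* [g'] differs from [g] only at time 0, where both values are [m]-close. *)
pose g' t := if t == 0 then p else g t.
have gg' u : mdist (g u) (g' u) <= m.
  rewrite /g'; case: eqP => [->|_]; first exact: mdist_leC.
  by rewrite mdistxx !le_min (ltW e20) (ltW r0) ltW.
rewrite (splitr eps); apply: traced_near (Hd g' _ _); last by rewrite /g' eqxx.
  by move=> u; apply: le_trans (gg' u) me.
move=> t s ts; rewrite /g'; case: (eqVneq t 0) => [->|t0]; rewrite ?add0r.
  case: (eqVneq s 0) => [->|s0]; first by rewrite phi0 mdistxx ltW.
  rewrite (splitr d); apply: (@mdist_le_trans _ _ _ (phi (g 0) s)).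
    apply: Hr; last exact: le_trans mr.
    by rewrite ger0_norm; lra.
  by have := q 0 s ts; rewrite add0r => gs; apply: le_trans gs md.
rewrite (splitr d); apply: (@mdist_le_trans _ _ _ (g (t + s))).
  exact: le_trans (q t s ts) md.
exact: le_trans (gg' (t + s)) md.
Qed.

Lemma POTP_Sh : POTP phi <-> Sh phi = setT.
Proof.
split=> [P|ST eps eps0].
  by apply/seteqP; split=> // p _ eps /P[d d0 H]; exists d => // xs ts po _; apply: H.
have [e e0 He] : exists2 e, 0 < e & forall g,
    quasi_orbit phi e 1 g -> traced phi eps g.
  have [d d' x dd H g q|p _|e e0 H] := compact_uniform_radius (P := fun d x =>
      forall g, quasi_orbit phi d 1 g -> g 0 = x -> traced phi eps g) cX.
  - by apply: H; apply: quasi_orbit_le q.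
  - have Sp : Sh phi p by rewrite ST.
    have [d d0 H] := Sh_locally_uniform Sp eps0.
    exists d => //; apply: filterS (near_mdist p d0) => x px g q gx.
    by apply: H; rewrite ?gx.
  - by exists e => // g q; apply: (H (g 0) I g q).
have [d d0 Hd] := star_quasi_orbit cX fphi (ltr01 : 0 < 1 :> R) e0.
by exists d => // xs ts po; apply: He; apply: Hd.
Qed.

End invariance_and_POTP.

(** * Reparametrizations of the line *)

Section reparametrizations.
Context {R : realType}.
Implicit Types h k : R -> R.

Lemma Rep_mono h : Rep h -> {mono h : x y / x <= y}.
Proof. by case=> inc _ _; apply: le_mono. Qed.

Lemma Rep_surj h t : Rep h -> exists s, h s = t.
Proof. by case=> _ hT _; have [s _ <-] : range h t; [rewrite hT | exists s]. Qed.

Lemma Rep_comp h k : Rep h -> Rep k -> Rep (h \o k).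
Proof.
move=> Rh Rk; have [[hi _ h0] [ki _ k0]] := (Rh, Rk).
split=> [s t /ki/hi //||]; last by rewrite /= k0.
apply/seteqP; split=> // t _; have [s <-] := Rep_surj t Rh.
by have [r <-] := Rep_surj s Rk; exists r.
Qed.

Lemma Rep_inv h : Rep h -> exists k, [/\ Rep k, cancel h k & cancel k h].
Proof.
move=> Rh; have /choice[k hk] t : exists s, h s = t by exact: Rep_surj.
have kK : cancel k h by [].
have hK : cancel h k.
  by move=> t; apply: (inc_inj (Rep_mono Rh)); rewrite hk.
exists k; split=> //; split.
- by move=> s t; rewrite -{1}(hk s) -{1}(hk t) (leW_mono (Rep_mono Rh)).
- by apply/seteqP; split=> // t _; exists (h t).
- by have [_ _ h0] := Rh; rewrite -h0 hK.
Qed.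

End reparametrizations.

(** * Chain recurrence under shadowing *)

Section chain_recurrence.
Context {R : realType} {X : metricType R} (phi : X -> R -> X).
Context (cX : compact [set: X]) (fphi : continuous_flow phi).
Implicit Types (p q y : X) (eps : R).

(** Reading the indices modulo [m] works because the end point [a m] equals the
    starting point [a 0]: the last jump leads back to it. *)
Lemma closed_chain_unroll delta T m a u p :
    (0 < m)%N -> chain phi delta T m a u -> a 0%N = p -> a m = p ->
  exists xs ts, [/\ pseudo_orbit phi delta T xs ts, xs 0 = p,
    forall i, xs (i + m%:Z) = xs i & forall i, ts (i + m%:Z) = ts i].
Proof.
move=> m0 [uT ad] a0 am; pose r (i : int) := `|(i %% m)%Z|%N.
have rD i : r (i + m%:Z) = r i by rewrite /r modzDr.
have rm i : (r i < m)%N by rewrite /r; have := ltz_mod i (_ : m%:Z != 0); lia.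
exists (a \o r), (u \o r); split=> [i|||].
- split; first by apply: uT; rewrite ltnW.
  suff -> : (a \o r) (i + 1) = a (r i).+1 by apply: ad.
  have mz : m%:Z != 0 by lia.
  have e : r (i + 1) = ((r i).+1 %% m)%N.
    rewrite /r -modzDml; have -> : (i %% m)%Z = (`|(i %% m)%Z|%N)%:Z.
      by rewrite gez0_abs // modz_ge0.
    by rewrite -PoszD addn1 modz_nat.
  rewrite /= e; have := rm i; rewrite leq_eqVlt => /predU1P[->|lt].
    by rewrite modnn a0 am.
  by rewrite modn_small.
- by rewrite /= /r mod0z.
- by move=> i; rewrite /= rD.
- by move=> i; rewrite /= rD.
Qed.

Lemma iter_period (A : Type) (f : int -> A) m n :
  (forall i, f (i + m) = f i) -> forall i, f (i + n%:Z * m) = f i.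
Proof.
move=> fm; elim: n => [|n IH] i; first by rewrite mul0r addr0.
have -> : i + n.+1%:Z * m = (i + n%:Z * m) + m by lia.
by rewrite fm.
Qed.

Lemma star_periodic xs ts T m : 0 < T -> (forall i, T <= ts i) ->
    (forall i, xs (i + m) = xs i) -> (forall i, ts (i + m) = ts i) ->
  forall u, star phi xs ts (u + switch_time ts m) = star phi xs ts u.
Proof.
move=> T0 tsT xm tm u.
have sm i : switch_time ts (i + m) = switch_time ts i + switch_time ts m.
  elim/int_rect: i => [|n IH|n IH]; first by rewrite switch_time0 !add0r.
    have -> : n.+1%:Z + m = n%:Z + m + 1 by lia.
    have -> : n.+1%:Z = n%:Z + 1 by lia.
    by rewrite !switch_timeS IH tm addrAC.
  move: IH; have -> : - n%:Z = - n.+1%:Z + 1 by lia.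
  by rewrite addrAC !switch_timeS tm; lra.
have [i ui] := switch_time_cover u T0 tsT.
rewrite (star_eq _ _ T0 tsT ui) (@star_eq _ _ _ _ _ T _ (i + m)) //.
  by rewrite xm sm opprD addrACA subrr addr0.
by rewrite addrAC !sm lerD2r ltrD2r.
Qed.

(** Tracing the periodic pseudo-orbit of a closed chain at [p].  Here [L] is a multiple
    of its period: since [h] is onto, [h L] exceeds any given bound.  The return to
    [p] serves the non-wandering property, the comparison of [u] and [u + L] serves
    expansiveness. *)
Lemma CR_Sh_trace p eps : CR phi p -> Sh phi p -> 0 < eps ->
  exists y h, [/\ Rep h, mdist p y <= eps &
    forall B, exists L, [/\ B <= h L, mdist p (phi y (h L)) <= eps &
      forall u, mdist (phi y (h u)) (phi y (h (u + L))) <= eps + eps]].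
Proof.
have [phi0 phiD _] := fphi.
move=> crp Shp eps0; have [d d0 H] := Shp _ eps0.
have [[m [a [u [m0 ch a0 am]]]] _] := crp d 1 d0 ltr01.
have [xs [ts [po x0 xm tm]]] := closed_chain_unroll m0 ch a0 am.
have ts1 i : 1 <= ts i by have [] := po i.
have st0 : star phi xs ts 0 = p by rewrite (star0 _ fphi ltr01).
have [y [h [Rh hy]]] := H _ _ po x0; have [_ _ h0] := Rh.
exists y, h; split=> //; first by have := hy 0; rewrite st0 h0 phi0.
move=> B; have [v hv] := Rep_surj B Rh.
(* Each switching step lasts at least 1, so [N] periods lead beyond [v]. *)
pose N := (Num.truncn `|v|).+1; exists (switch_time ts (N%:Z * m%:Z)).
have stP w : star phi xs ts (w + switch_time ts (N%:Z * m%:Z)) = star phi xs ts w.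
  by apply: (star_periodic ltr01 ts1) => i; apply: iter_period.
split.
- rewrite -hv (Rep_mono Rh); apply: (le_trans (ler_norm v)).
  apply: (@le_trans _ _ N%:R); first by rewrite ltW // truncnS_gt.
  have := switch_time_ge 0 (N * m) ts1.
  rewrite switch_time0 !add0r mulr1 PoszM; apply: le_trans.
  by rewrite ler_nat leq_pmulr.
- by rewrite -{1}st0 -(stP 0) add0r.
- move=> w; apply: mdist_le_trans (hy _); rewrite stP.
  exact: mdist_leC.
Qed.

Lemma CR_Sh_Omega p : CR phi p -> Sh phi p -> Omega phi p.
Proof.
move=> crp Shp U /nbhs_mdist[e e0 eU] T.
have [y [h [_ py /(_ T)[L [TL pL _]]]]] := CR_Sh_trace crp Shp e0.
exists (h L) => //; exists (phi y (h L)); split; last exact: eU.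
by exists y => //; apply: eU.
Qed.

(** If [x] and [phi x t] are near [p] with [t] large, the chain [p, phi x T, p] is
    closed: it leaves the orbit of [p] for that of [x] after the time [T]. *)
Lemma Omega_sub_CR : Omega phi `<=` CR phi.
Proof.
have [phi0 phiD _] := fphi.
move=> p Op d T d0 T0.
suff C : chain_connects phi d T p p by split.
have [r r0 Hr] := flow_equicontinuous T cX fphi d0.
have m0 : 0 < Num.min d r by rewrite lt_min d0.
have [t Tt [_ [[x /= px <-] pxt]]] := Op _ (near_mdist p m0) (T + T).
exists 2%N, (fun i => if i == 1%N then phi x T else p),
  (fun i => if i == 1%N then t - T else T); split=> //; split=> [[|[|[|//]]]|[|[|//]]] //= _.
- lra.
- apply: Hr; first by rewrite gtr0_norm.
  by apply: le_trans px _; rewrite ge_min lexx orbT.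
- rewrite phiD subrKC; apply: mdist_leC; apply: le_trans pxt _.
  by rewrite ge_min lexx.
Qed.

Lemma closure_Omega : closure (Omega phi) `<=` Omega phi.
Proof.
move=> p cp U; rewrite nbhsE => -[V [oV Vp] VU] T.
have [q [Oq Vq]] := cp V (open_nbhs_nbhs (conj oV Vp)).
have [t Tt [z [[x Vx xz] Vz]]] := Oq V (open_nbhs_nbhs (conj oV Vq)) T.
by exists t => //; exists z; split; [exists x => //; apply: VU | apply: VU].
Qed.

Lemma phi_period y t n : phi y t = y -> phi y (n%:R * t) = y.
Proof.
have [phi0 phiD _] := fphi => yt.
elim: n => [|n IH]; first by rewrite mul0r phi0.
by rewrite -natr1 mulrDl mul1r -phiD IH.
Qed.

Lemma returning_Omega y t : 0 < t -> phi y t = y -> Omega phi y.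
Proof.
move=> t0 yt U /nbhs_singleton Uy T.
exists ((Num.truncn (`|T| / t)).+1%:R * t).
  apply: le_trans (ler_norm T) _.
  by rewrite -ler_pdivrMr // ltW // truncnS_gt.
by exists y; split=> //; exists y => //; apply: phi_period.
Qed.

(** If the positive return times are bounded away from 0, one close to their infimum is
    the least, since a difference of two return times is a return time.  If they are
    not, any [s] is a return time up to an arbitrarily small error, hence [y] is
    fixed by continuity. *)
Lemma returning_Per_or_Sing y t : 0 < t -> phi y t = y ->
  Per phi y \/ Sing phi y.
Proof.
have [phi0 phiD cphi] := fphi => t0 yt.
pose P := [set s | 0 < s /\ phi y s = y].
have [[e e0 Pe]|small] :=
    pselect (exists2 e, 0 < e & forall s, P s -> e <= s); [left|right].
  have hP : has_inf P by split; [exists t | exists 0 => s [/ltW]].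
  have [s [s0 ys] sinf] := inf_adherent e0 hP.
  exists s; split=> // r r0 yr; rewrite leNgt; apply/negP => rs.
  have Psr : P (s - r).
    split; first by rewrite subr_gt0.
    by rewrite -{1}yr phiD subrKC.
  have := Pe _ Psr; have := ge_inf hP.2 (conj r0 yr : P r); lra.
move=> s; apply/esym/mdist_positivity/eqP.
rewrite eq_le mdist_ge0 andbT; apply/ler_addgt0Pl => e e0; rewrite addr0.
have [[A B] /= [nA [d /= d0 Bd]] AB] := cphi (y, 0) _ (near_mdist (phi y 0) e0).
have Hd r : `|r| < d -> mdist y (phi y r) <= e.
  move=> rd; rewrite -{1}(phi0 y); apply: (AB (y, r)); split.
    exact: nbhs_singleton.
  by apply: Bd; rewrite /= sub0r normrN.
have [r [r0 yr] rd] : exists2 r, P r & r < d.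
  apply: contrapT => nr; apply: small; exists d => // r Pr.
  by rewrite leNgt; apply/negP => rd; apply: nr; exists r.
have yz (n : int) : phi y (n%:~R * r) = y.
  case: n => n; first exact: phi_period.
  rewrite NegzE mulrNz mulNr -{1}(phi_period n.+1 yr) phiD subrr //.
have /andP[lo hi] := floor_itv (s / r).
move: lo hi; set n := Num.floor _; rewrite ler_pdivlMr // ltr_pdivrMr //.
rewrite intrD mulrDl mul1r => lo hi.
rewrite -[s](subrKC (n%:~R * r)) -phiD yz.
by apply: Hd; rewrite ger0_norm; lra.
Qed.

(** With [k] the inverse of [h], the orbit of [y] at time [s = h (k s)] is close to itself
    at time [h (k s + L)], which is the orbit of [phi y (h L)] at time [g s] for the
    reparametrization [g] below.  Expansiveness gives [phi y (h L) = phi y r] with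
    [|r| < 1 <= h L], so [y] returns to itself after the positive time [h L - r]. *)
Lemma expansive_CR_Sh_near p eps : expansive phi -> CR phi p -> Sh phi p ->
  0 < eps -> exists2 y, mdist p y <= eps & (Per phi `|` Sing phi) y.
Proof.
have [phi0 phiD _] := fphi; move=> ex crp Shp eps0.
have [d d0 Hd] := ex 1 ltr01.
have e0 : 0 < Num.min eps (d / 2) by rewrite lt_min eps0 divr_gt0.
have [y [h [Rh py /(_ 1)[L [L1 _ hL]]]]] := CR_Sh_trace crp Shp e0.
exists y; first by apply: le_trans py _; rewrite ge_min lexx.
have [k [Rk hK kK]] := Rep_inv Rh.
have [[_ _ h0] [_ _ k0]] := (Rh, Rk).
pose g s := h (k s + L) - h L.
have Rg : Rep g.
  split; last by rewrite /g k0 add0r subrr.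
    move=> s t st; rewrite /g ltrD2r (leW_mono (Rep_mono Rh)) ltrD2r.
    by rewrite (leW_mono (Rep_mono Rk)).
  apply/seteqP; split=> // v _; exists (h (k (v + h L) - L)) => //.
  by rewrite /g hK subrK kK addrK.
have [t|r /= rr yr] := Hd y (phi y (h L)) g Rg.
  rewrite phiD /g subrKC -{1}(kK t); apply: le_trans (hL _) _.
  have : Num.min eps (d / 2) <= d / 2 by rewrite ge_min lexx orbT.
  by lra.
apply: (@returning_Per_or_Sing y (h L - r)); first by lra.
by rewrite -phiD -yr phiD subrr phi0.
Qed.

Lemma closure_Sing : closure (Sing phi) `<=` Sing phi.
Proof.
move=> p cp t; apply: mdist_positivity; apply/eqP.
rewrite eq_le mdist_ge0 andbT; apply/ler_addgt0Pl => e e0; rewrite addr0.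
have e20 : 0 < e / 2 by rewrite divr_gt0.
have [d d0 Hd] := flow_equicontinuous `|t| cX fphi e20.
have m0 : 0 < Num.min d (e / 2) by rewrite lt_min d0.
have [q [Sq /= pq]] := cp _ (near_mdist p m0).
rewrite (splitr e); apply: (@mdist_le_trans _ _ _ q).
  rewrite -(Sq t); apply: Hd => //.
  by apply: le_trans pq _; rewrite ge_min lexx.
by apply: mdist_leC; apply: le_trans pq _; rewrite ge_min lexx orbT.
Qed.

Lemma CR_expansive : expansive phi -> CR phi `<=` Sh phi ->
  CR phi = closure (Per phi) `|` Sing phi.
Proof.
move=> ex CS; apply/seteqP; split=> [p crp|p [cp|Sp]].
- suff : closure (Per phi `|` Sing phi) p.
    by rewrite closureU => -[|/closure_Sing]; [left|right].
  move=> U /nbhs_mdist[e e0 eU].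
  have [y py Py] := expansive_CR_Sh_near ex crp (CS _ crp) e0.
  by exists y; split=> //; apply: eU.
- apply/Omega_sub_CR/closure_Omega; apply: closure_subset cp => x [t [t0 xt _]].
  exact: returning_Omega xt.
- by apply/Omega_sub_CR/(returning_Omega ltr01).
Qed.

End chain_recurrence.

(** * Equivalent flows *)

Section flow_equivalences.
Context {R : realType}.

(** Consecutive pieces match at the switching times because [k i] sends the jump time
    [ts i] to [ts' i]. *)
Lemma Rep_glue (ts ts' : int -> R) (k : int -> R -> R) (T T' : R) :
    0 < T -> 0 < T' -> (forall i, T <= ts i) -> (forall i, T' <= ts' i) ->
    (forall i, Rep (k i)) -> (forall i, k i (ts i) = ts' i) ->
  exists2 H, Rep H & forall i u,
    switch_time ts i <= u < switch_time ts (i + 1) ->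
    H u = switch_time ts' i + k i (u - switch_time ts i).
Proof.
move=> T0 T'0 tsT tsT' Rk kts.
pose H u := let i := star_index ts u in
  switch_time ts' i + k i (u - switch_time ts i).
have HE i u : switch_time ts i <= u < switch_time ts (i + 1) ->
    H u = switch_time ts' i + k i (u - switch_time ts i).
  by move=> ui; rewrite /H (star_index_eq T0 tsT ui).
have mono := switch_time_mono T0 tsT; have mono' := switch_time_mono T'0 tsT'.
exists H => //; split.
- move=> u v uv; have [i ui] := switch_time_cover u T0 tsT.
  have [j vj] := switch_time_cover v T0 tsT.
  rewrite (HE _ _ ui) (HE _ _ vj); move: ui vj => /andP[iu ui] /andP[jv vj].
  have [ij|ji|<-] := ltgtP i j.
  + apply: (@lt_le_trans _ _ (switch_time ts' (i + 1))).
      rewrite switch_timeS ltrD2l -kts (leW_mono (Rep_mono (Rk i))).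
      by rewrite ltrBlDl -switch_timeS.
    apply: (@le_trans _ _ (switch_time ts' j)).
      by apply: mono'; rewrite lezD1.
    by rewrite lerDl; have [_ _ <-] := Rk j; rewrite (Rep_mono (Rk j)) subr_ge0.
  + exfalso; have : switch_time ts (j + 1) <= switch_time ts i.
      by apply: mono; rewrite lezD1.
    lra.
  + by rewrite ltrD2l (leW_mono (Rep_mono (Rk i))) ltrD2r.
- apply/seteqP; split=> // w _; have [j /andP[jw wj]] := switch_time_cover w T'0 tsT'.
  have [r kr] := Rep_surj (w - switch_time ts' j) (Rk j).
  have [_ _ k0] := Rk j.
  have r0 : 0 <= r by rewrite -(Rep_mono (Rk j)) kr k0 subr_ge0.
  have rt : r < ts j.
    by rewrite -(leW_mono (Rep_mono (Rk j))) kr kts ltrBlDl -switch_timeS.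
  exists (switch_time ts j + r) => //.
  rewrite (HE j); last by rewrite switch_timeS lerDl r0 ltrD2l.
  by rewrite addrAC subrr add0r kr subrKC.
- rewrite (HE 0); last by rewrite switch_timeS switch_time0 add0r lexx (lt_le_trans T0).
  by rewrite !switch_time0 subr0 add0r; have [_ _ ->] := Rk 0.
Qed.

(** The pullback of a pseudo-orbit of [psi] is a pseudo-orbit of [phi] with jump times at
    least [c] whose curve, read along the glued time change [H], is the pullback of
    the original curve.  The bound [c] keeps these jump times away from 0, so that a
    window of length 1 meets a bounded number of jumps. *)
Lemma equivalence_Sh_sub (X Y : metricType R) (phi : X -> R -> X)
    (psi : Y -> R -> Y) (f : X -> Y) (g : Y -> X) (k : X -> R -> R) (c : R) :
    compact [set: X] -> compact [set: Y] ->
    continuous_flow phi -> continuous_flow psi ->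
    continuous f -> continuous g -> cancel f g -> cancel g f ->
    (forall x, Rep (k x)) -> 0 < c -> (forall x, c <= k x 1) ->
    (forall x t, g (psi (f x) t) = phi x (k x t)) ->
  forall p, Sh phi p -> Sh psi (f p).
Proof.
move=> cX cY fphi fpsi cf cg fK gK Rk c0 ck gpsi p /(ShP _ cX fphi) Sp eps eps0.
have unif (A B : metricType R) (e : R) (F : A -> B) : compact [set: A] ->
    continuous F -> 0 < e -> exists2 d, 0 < d &
    forall x y, mdist x y <= d -> mdist (F x) (F y) <= e.
  move=> cA cF e0.
  have cF1 : continuous (F \o fst : A * R -> B).
    by move=> z; apply: continuous_comp; [exact: cvg_fst | exact: cF].
  have [d d0 Hd] := compact_equicontinuous_dist cA (@compact_set1 _ (0 : R)) cF1 e0.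
  by exists d => // x y; apply: (Hd x y 0).
have [d1 d10 H1] := unif _ _ _ _ cX cf eps0.
have [d2 d20 H2] := Sp _ d10.
have [d3 d30 H3] := quasi_orbitM (Num.truncn c^-1) cX fphi c0 d20.
have [d4 d40 H4] := star_quasi_orbit cX fphi c0 d30.
have [d5 d50 H5] := unif _ _ _ _ cY cg d40.
exists d5 => // ys ts po y0.
pose xs i := g (ys i); pose ts' i := k (xs i) (ts i).
have ts1 i : 1 <= ts i by have [] := po i.
have ts'c i : c <= ts' i by apply: le_trans (ck (xs i)) _; rewrite (Rep_mono (Rk _)).
have gpsi' y t : phi (g y) (k (g y) t) = g (psi y t) by rewrite -gpsi gK.
have po' : pseudo_orbit phi d4 c xs ts'.
  by move=> i; split=> //; rewrite gpsi'; apply: H5; have [] := po i.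
have [H RH HE] := Rep_glue ltr01 c0 ts1 ts'c (fun i => Rk (xs i)) (fun i => erefl).
have starH u : star phi xs ts' (H u) = g (star psi ys ts u).
  have [i ui] := switch_time_cover u ltr01 ts1.
  rewrite (star_eq _ _ ltr01 ts1 ui) (HE _ _ ui).
  move: ui; rewrite switch_timeS => /andP[iu ui].
  rewrite (@star_eq _ _ _ _ _ c _ i) //.
    by rewrite addrAC subrr add0r gpsi'.
  rewrite switch_timeS lerDl ltrD2l (leW_mono (Rep_mono (Rk _))) ltrBlDl ui andbT.
  by have [_ _ <-] := Rk (xs i); rewrite (Rep_mono (Rk _)) subr_ge0.
have [t s /andP[s0 s1]||z [h [Rh zh]]] := H2 (star phi xs ts').
(* Windows of length 1 fit into [truncn c^-1 + 1] windows of length [c]. *)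
- apply: (H3 _ (H4 _ _ po')); rewrite s0 (le_trans s1) //.
  by rewrite -ler_pdivrMr // div1r ltW // truncnS_gt.
- by rewrite (star0 _ fphi c0) // /xs y0 fK.
have [kz [Rkz _ kzK]] := Rep_inv (Rk z).
exists (f z), (kz \o (h \o H)); split.
  by apply: Rep_comp => //; apply: Rep_comp.
move=> u /=; have -> : psi (f z) (kz (h (H u))) = f (phi z (h (H u))).
  by rewrite -[LHS]gK gpsi kzK.
by rewrite -(gK (star psi ys ts u)) -starH; apply: H1.
Qed.

Lemma compact_open_eval (X : topologicalType) (h : X -> R -> R) t :
  continuous (h : X -> {compact-open, R -> R}) -> continuous (h ^~ t).
Proof.
move=> ch; apply/continuousP => O oO.
rewrite (_ : _ @^-1` O = h @^-1` [set k | k @` [set t] `<=` O]); last first.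
  by apply/seteqP; split=> x /=; rewrite image_set1 sub1set inE.
move/continuousP: ch; apply; apply: compact_open_open => //.
exact: compact_set1.
Qed.

(** The inverse map is again an equivalence in the sense of the previous lemma, with
    the inverse time changes.  The bound [c <= k y 1] needed for them reads
    [h x c <= 1]; like the bound for [h], it follows from compactness and the
    continuity in [x] of [h x t] for a single [t]. *)
Lemma equivalence_Sh (X Y : metricType R) (phi : X -> R -> X)
    (psi : Y -> R -> Y) (f : X -> Y) :
    compact [set: X] -> continuous_flow phi -> continuous_flow psi ->
    flow_equivalence phi psi f ->
  f @` Sh phi = Sh psi.
Proof.
move=> cX fphi fpsi [g [[cf cg fK gK] [_ [h [Rh /compact_open_eval ch gpsi]]]]].
have cY : compact [set: Y].
  have -> : [set: Y] = f @` [set: X].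
    by apply/seteqP; split=> // y _; exists (g y).
  by apply: continuous_compact => //; apply: continuous_subspaceT.
have [d d' x|x _|c c0 hc] :=
    compact_uniform_radius (P := fun c x => c <= h x 1) cX.
- exact: le_trans.
- have hx0 : 0 < h x 1 by have [inc _ <-] := Rh x; apply: inc.
  exists (h x 1 / 2); first by rewrite divr_gt0.
  by apply: (cvgr_ge (h x 1)); [exact: ch | lra].
have [d d' x dd|x _|c' c'0 hc'] :=
    compact_uniform_radius (P := fun c x => h x c <= 1) cX.
- by apply: le_trans; rewrite (Rep_mono (Rh x)).
- have [s hs] := Rep_surj (1 / 2) (Rh x); exists s.
    by rewrite -(leW_mono (Rep_mono (Rh x))) hs; have [_ _ ->] := Rh x; lra.
  by apply: (cvgr_le (h x s)); [exact: ch | rewrite hs; lra].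
have /choice[k hk] x := Rep_inv (Rh x).
apply/seteqP; split=> [_ [p Sp <-]|q Sq].
  exact: (equivalence_Sh_sub cX cY fphi fpsi cf cg fK gK Rh c0 (fun x => hc x I)
    gpsi Sp).
exists (g q) => //.
have Rk y : Rep ((k \o g) y) by have [] := hk (g y).
have k1 y : c' <= (k \o g) y 1.
  have [_ hkK _] := hk (g y); rewrite -[c']hkK (Rep_mono (Rk y)).
  exact: (hc' (g y) I).
have fphig y t : f (phi (g y) t) = psi y ((k \o g) y t).
  by have [_ _ kK] := hk (g y); rewrite /= -{1}(kK t) -gpsi !gK.
exact: (equivalence_Sh_sub cY cX fpsi fphi cg cf gK fK Rk c'0 k1 fphig Sq).
Qed.

End flow_equivalences.

(** * Identity flows on sets of reals *)

Section real_subsets.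
Context {R : realType} (A : set R).

Let dist (x y : A) : R := `|\val x - \val y|.

Let dist_ge0 x y : 0 <= dist x y.
Proof. exact: normr_ge0. Qed.

Let dist_eq0 x y : dist x y = 0 -> x = y.
Proof. by move/normr0_eq0/eqP; rewrite subr_eq0 => /eqP/val_inj. Qed.

Let ballE (x : A) d : ball x d = [set y | dist x y < d].
Proof. by []. Qed.

HB.instance Definition _ :=
  @PseudoMetric_isMetric.Build R (A : Type) dist dist_ge0 dist_eq0 ballE.

Lemma mdist_set_type (x y : A) : mdist x y = `|\val x - \val y|.
Proof. by []. Qed.

(** A filter on the subtype is pushed to the reals; a cluster point of the image in [A]
    is a cluster point upstairs, the balls of the subtype being traces of balls. *)
Lemma compact_set_type : compact A -> compact [set: A].
Proof.
move=> cA F PF _.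
have FA : (\val @ F) A.
  by apply: (@filterS _ F _ setT) => [x _|]; [exact: set_valP | exact: filterT].
have [z [Az clz]] := cA (\val @ F) _ FA.
exists (exist _ z (mem_set Az)); split=> // B C FB /nbhs_mdist[e e0 eC].
have FB' : (\val @ F) (\val @` B)
  by apply: (@filterS _ F _ B) FB => x Bx; exists x.
have [_ [[x Bx <-] zx]] := clz _ _ FB' (nbhsx_ballx z e e0).
by exists x; split=> //; apply: eC; rewrite mdist_set_type ltW.
Qed.

End real_subsets.

Section identity_flow.
Context {R : realType}.

Definition identity_flow (Y : Type) (x : Y) (t : R) : Y := x.

Lemma identity_flow_continuous (Y : metricType R) :
  continuous_flow (@identity_flow Y).
Proof. by split=> // z; apply: cvg_fst. Qed.

(** Pseudo-orbits with jumps smaller than the distance to the other points are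
    constant. *)
Lemma isolated_Sh (Y : metricType R) (p : Y) (d : R) : 0 < d ->
  (forall y, mdist p y <= d -> y = p) -> Sh (@identity_flow Y) p.
Proof.
move=> d0 iso eps eps0; exists d => // xs ts po x0.
have xp i : xs i = p.
  elim/int_rect: i => // n IH.
    have [_] := po n; rewrite /identity_flow IH => /iso <-.
    by congr xs; lia.
  have [_] := po (- n.+1%:Z); rewrite /identity_flow.
  have -> : - n.+1%:Z + 1 = - n%:Z by lia.
  by rewrite IH => /mdist_leC/iso.
exists p, id; split; last by move=> u; rewrite /star xp mdistxx ltW.
by split=> //; apply/seteqP; split=> // t _; exists t.
Qed.

(** The curve [t |-> p + d t], stopped at the ends of the interval, is a quasi-orbit that
    reaches both [a] and [b]; an orbit, being a single point, cannot be within a third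
    of [b - a] of both. *)
Lemma interval_not_Sh (A : set R) (a b : R) (p : A) :
    compact A -> a < b -> `[a, b] `<=` A -> a <= \val p <= b ->
  ~ Sh (@identity_flow A) p.
Proof.
move=> cA ab abA /andP[ap pb].
move=> /(ShP _ (compact_set_type cA) (identity_flow_continuous A)) Sp.
have e0 : 0 < (b - a) / 3 by rewrite divr_gt0 ?subr_gt0.
have [d d0 H] := Sp _ e0.
(* [clamp] is 1-Lipschitz, so a drift of speed [d] is a [d]-fine quasi-orbit. *)
pose clamp x := Num.max a (Num.min b x).
have clampA x : clamp x \in A.
  by apply/mem_set/abA; rewrite /= in_itv /= le_max lexx ge_max ge_min lexx (ltW ab).
have clampE x : a <= x <= b -> clamp x = x.
  by move=> /andP[ax xb]; rewrite /clamp (min_idPr xb) (max_idPr ax).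
pose g t : A := exist _ (clamp (\val p + d * t)) (clampA _).
have [t s /andP[s0 s1]||y [h [_ gy]]] := H g.
- rewrite mdist_set_type /= mulrDr addrA.
  have ds0 : 0 <= d * s by rewrite mulr_ge0 // ltW.
  have ds1 : d * s <= d by rewrite ler_piMr // ltW.
  move: (_ + d * t) ds0 ds1 => x; move: (d * s) => r r0 rd.
  by rewrite /clamp /Num.max /Num.min ler_norml; do ![case: ifP]; move=> *; lra.
- by apply: val_inj; rewrite /= mulr0 addr0 clampE ?ap.
have reach x : a <= x <= b -> `|x - \val y| <= (b - a) / 3.
  move=> xab; have := gy ((x - \val p) / d).
  by rewrite mdist_set_type /= mulrC divfK ?gt_eqF // subrKC clampE.
have := reach a; have := reach b; rewrite !lexx (ltW ab) !ler_norml.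
by move=> /(_ isT)/andP[? ?] /(_ isT)/andP[? ?]; lra.
Qed.

Lemma empty_Sh_example : exists (Y : metricType R) (psi : Y -> R -> Y),
  [/\ compact [set: Y], [set: Y] !=set0, continuous_flow psi & Sh psi = set0].
Proof.
have cI : compact (`[0, 1] : set R) by exact: segment_compact.
exists (`[0%R, 1%R]%classic : set R), (@identity_flow _); split.
- exact: compact_set_type.
- have I0 : (0 : R) \in `[0, 1]%classic by rewrite inE /= in_itv /= lexx ler01.
  by exists (exist _ 0 I0).
- exact: identity_flow_continuous.
- apply/seteqP; split=> // p; apply: (interval_not_Sh cI ltr01) => //.
  by have := set_valP p; rewrite /= in_itv.
Qed.

(** This is [[-1, 0]] together with all [1 / (n + 1)]; removing open gaps from [[-1, 1]]
    makes it visibly closed. *)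
Definition gap_set : set R :=
  `[-1, 1] `&` \bigcap_n ~` `](n.+2%:R^-1), (n.+1%:R^-1)[.

Lemma gap_set_compact : compact gap_set.
Proof.
apply: (subclosed_compact _ (@segment_compact _ (-1) 1)) => [|x []//].
apply: closedI; first exact: interval_closed.
by apply: closed_bigI => n _; apply: open_closedC; apply: interval_open.
Qed.

Lemma gap_set_inv n : n.+1%:R^-1 \in gap_set.
Proof.
have n0 : 0 < n.+1%:R^-1 :> R by rewrite invr_gt0.
have n1 : n.+1%:R^-1 <= 1 :> R by rewrite invf_le1 // ler1n.
apply/mem_set; split.
  by rewrite /= in_itv /= n1 andbT; apply: le_trans (ltW n0); rewrite oppr_le0.
move=> m _ /=; rewrite in_itv /= => /andP[].
by rewrite !ltf_pV2 ?posrE // !ltr_nat; lia.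
Qed.

Lemma gap_set0 : (0 : R) \in gap_set.
Proof.
apply/mem_set; split; first by rewrite /= in_itv /=; lra.
by move=> m _ /=; rewrite in_itv /= ltNge invr_ge0 ler0n.
Qed.

Definition gap_point n : gap_set := exist _ n.+1%:R^-1 (gap_set_inv n).

(** Isolation comes from the two gaps adjacent to the point, so the rightmost point
    [1], which has a gap on one side only, is left out. *)
Lemma gap_point_Sh n : Sh (@identity_flow gap_set) (gap_point n.+1).
Proof.
have lt m : m.+2%:R^-1 < m.+1%:R^-1 :> R by rewrite ltf_pV2 ?posrE // ltr_nat.
have := lt n; have := lt n.+1.
set c := n.+3%:R^-1; set b := n.+2%:R^-1; set a := n.+1%:R^-1 => cb ba.
apply: (@isolated_Sh _ _ (Num.min (b - c) (a - b) / 2)).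
  by rewrite divr_gt0 // lt_min !subr_gt0 cb.
move=> y yb; apply: val_inj; move: yb (set_valP y).2.
rewrite mdist_set_type -[\val (gap_point _)]/b; move: (\val y) => v.
rewrite ler_norml => /andP[lo hi] gap.
have m1 : Num.min (b - c) (a - b) <= b - c by rewrite ge_min lexx.
have m2 : Num.min (b - c) (a - b) <= a - b by rewrite ge_min lexx orbT.
apply/eqP; rewrite eq_le !leNgt; apply/andP; split; apply/negP => vb.
  by apply: (gap n I); rewrite /= in_itv /= -/a -/b vb; lra.
by apply: (gap n.+1 I); rewrite /= in_itv /= -/c -/b vb andbT; lra.
Qed.

Lemma noncompact_Sh_example : exists (Y : metricType R) (psi : Y -> R -> Y),
  [/\ compact [set: Y], continuous_flow psi & ~ compact (Sh psi)].
Proof.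
exists gap_set, (@identity_flow _); split.
- exact: compact_set_type gap_set_compact.
- exact: identity_flow_continuous.
move=> /(compact_closed (@metric_hausdorff _ _)) cSh.
pose o : gap_set := exist _ 0 gap_set0.
have So : Sh (@identity_flow gap_set) o.
  apply: cSh => U /nbhs_mdist[e e0 eU].
  exists (gap_point (Num.truncn e^-1).+1); split.
    exact: gap_point_Sh.
  apply: eU; rewrite mdist_set_type /= sub0r normrN ger0_norm ?invr_ge0 //.
  rewrite -[leRHS]invrK lef_pV2 ?posrE ?invr_gt0 //.
  by apply: ltW; apply: lt_trans (truncnS_gt _) _; rewrite ltr_nat.
apply: (@interval_not_Sh gap_set (-1) 0 o gap_set_compact _ _ _ So).
- by lra.
- move=> x; rewrite /= in_itv /= => /andP[x1 x0]; split.
    by rewrite /= in_itv /=; lra.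
  move=> m _ /=; rewrite in_itv /= => /andP[+ _].
  by rewrite ltNge (le_trans x0) // invr_ge0.
- by rewrite /= lexx andbT oppr_le0.
Qed.

End identity_flow.

(** * Properties of the set of shadowable points *)

Theorem theorem2p5 (R : realType) (X : metricType R) (phi : X -> R -> X)
    (cptX : compact [set: X]) (flow_phi : continuous_flow phi) :
  [/\ [/\ flow_invariant phi (Sh phi),
          exists (Y : metricType R) (psi : Y -> R -> Y),
            [/\ compact [set: Y], [set: Y] !=set0, continuous_flow psi
              & Sh psi = set0]
        & exists (Y : metricType R) (psi : Y -> R -> Y),
            [/\ compact [set: Y], continuous_flow psi & ~ compact (Sh psi)]],
      POTP phi <-> Sh phi = setT,
      CR phi `<=` Sh phi -> CR phi = Omega phi,
      expansive phi -> CR phi `<=` Sh phi ->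
        CR phi = closure (Per phi) `|` Sing phi
    & forall (Y : metricType R) (psi : Y -> R -> Y) (f : X -> Y),
        continuous_flow psi -> flow_equivalence phi psi f ->
        f @` Sh phi = Sh psi].
Proof.
split.
- split.
  + exact: Sh_invariant.
  + exact: empty_Sh_example.
  + exact: noncompact_Sh_example.
- exact: POTP_Sh.
- move=> CS; apply/seteqP; split=> [p crp|].
    exact: CR_Sh_Omega crp (CS _ crp).
  exact: Omega_sub_CR.
- exact: CR_expansive.
- by move=> Y psi f fpsi; apply: equivalence_Sh.
Qed.
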